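(* Let $n\ge3$ and consider the round sphere $\mathbb S^n$. (i) For all integers $N\ge1$, with $2N\le n$ if $n$ is even, $$2\Lambda_{2N}+\sum_{j=1}^{N-1}\frac{j(N-j)}N\binom Nj^2\Lambda_{2N-2j}\Lambda_{2j}=(-1)^NN!\,(N-1)!\,2^{2N}v_{2N}.$$ (ii) As formal power series in $r$, $$\mathcal G\Big(\frac{r^2}4\Big)=\sqrt{v(r)},\qquad\text{where}\quad \mathcal G(r)=1+\sum_{N\ge1}(-1)^N\Lambda_{2N}\frac{r^N}{N!\,(N-1)!}.$$
   Context: $\Delta$ is the Laplacian of the unit round sphere $\mathbb S^n$ with $-\Delta\ge0$. The GJMS-operators of $\mathbb S^n$ are, for all $N\ge1$, $P_{2N}=\prod_{j=0}^{N-1}(P_2+j(j+1))$ with $P_2=\Delta-\frac n2(\frac n2-1)$. The $Q$-curvatures are defined by $P_{2N}(1)=(-1)^N(\frac n2-N)Q_{2N}$ (for $2N=n$ by continuation in the dimension); on $\mathbb S^n$ they are the constants $Q_{2N}=\frac n2\prod_{j=1}^{N-1}(\frac n2-j)(\frac n2+j)$, $N\ge1$. For a composition $I=(I_1,\dots,I_r)$ (finite sequence of integers $I_j\ge1$) put $|I|=I_1+\dots+I_r$, $P_{2I}=P_{2I_1}\circ\cdots\circ P_{2I_r}$ and $$m_I=-(-1)^r|I|!\,(|I|-1)!\prod_{j=1}^r\frac1{I_j!\,(I_j-1)!}\prod_{j=1}^{r-1}\frac1{I_j+I_{j+1}}.$$ The primary part $\mathcal Q_{2N}$ of $Q_{2N}$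 is defined by $\mathcal Q_2=0$ and, for $N\ge2$, $$(-1)^N\mathcal Q_{2N}=-\sum_{a+|J|=N,\ a\ne N}m_{(J,a)}(-1)^aP_{2J}(Q_{2a}),$$ where $J$ runs over compositions and $a\ge 1$ over integers. Set $\Lambda_{2N}=Q_{2N}-\mathcal Q_{2N}$. The Poincaré-Einstein metric associated to $g=g_{\mathbb S^n}$ is $g_+=r^{-2}(dr^2+g_r)$ with $g_r=(1-r^2/4)^2g$. The holographic coefficients $v_{2j}$ are defined by $v(r)=\mathrm{vol}(g_r)/\mathrm{vol}(g)=1+v_2r^2+v_4r^4+\cdots$; thus here $v(r)=(1-r^2/4)^n$. *)

(* Defs.v *)
From HB Require Import structures.
From mathcomp Require Import all_boot all_order all_algebra.
From mathcomp Require Import all_classical all_reals all_analysis.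
Set Implicit Arguments.
Unset Strict Implicit.
Unset Printing Implicit Defensive.
From mathcomp Require Import ring.
Import Order.TTheory GRing.Theory Num.Theory.
Import numFieldNormedType.Exports.
Local Open Scope classical_set_scope.
Local Open Scope ring_scope.

Section Sphere.
Variable R : realType.
Implicit Types (n N : nat) (I : seq nat).

Definition on_sphere n (x : 'rV[R]_n.+1) : bool := \sum_i x 0 i ^+ 2 == 1.

Definition sphere n := {x : 'rV[R]_n.+1 | on_sphere x}.

Lemma pole_subproof n : on_sphere (delta_mx 0 0 : 'rV[R]_n.+1).
Proof.
rewrite /on_sphere (bigD1 ord0) //= big1 ?addr0 => [|i i0].
  by rewrite mxE !eqxx expr1n.
by rewrite mxE eqxx (negbTE i0) expr0n.
Qed.

Definition pole n : sphere n := exist _ (delta_mx 0 0) (pole_subproof n).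

(* [y |-> f (y / |y|)]; the value at the origin is arbitrary. *)
Definition radial_ext n (f : sphere n -> R) (y : 'rV[R]_n.+1) : R :=
  f (insubd (pole n) ((Num.sqrt (\sum_i y 0 i ^+ 2))^-1 *: y)).

(* The Laplacian of the round metric on the unit sphere is the restriction to
   the sphere of the Euclidean Laplacian of the extension that is homogeneous
   of degree 0. *)
Definition laplacian n (f : sphere n -> R) (x : sphere n) : R :=
  \sum_(i < n.+1)
    'D_(delta_mx 0 i) (fun y => 'D_(delta_mx 0 i) (radial_ext f) y) (val x).

Definition yamabe n (f : sphere n -> R) (x : sphere n) : R :=
  laplacian f x - n%:R / 2 * (n%:R / 2 - 1) * f x.

Definition gjms n N : (sphere n -> R) -> sphere n -> R :=
  \big[(fun S T => S \o T)/id]_(0 <= j < N)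
    (fun f x => yamabe f x + (j * j.+1)%:R * f x).

Definition gjms_comp n I : (sphere n -> R) -> sphere n -> R :=
  \big[(fun S T => S \o T)/id]_(k <- I) @gjms n k.

(* Meaningful for [n != N.*2] only. *)
Definition Qcurv_generic n N (x : sphere n) : R :=
  (-1) ^+ N * gjms N (cst 1) x / (n%:R / 2 - N%:R).

(* [Q_{2N}] as a polynomial in the dimension [m]; it is determined by its
   values at the infinitely many [m != N.*2]. *)
Definition Qcurv_poly N : {poly R} :=
  xget 0 [set q : {poly R} | forall m (x : sphere m),
    (0 < m)%N -> m != N.*2 -> Qcurv_generic N x = q.[m%:R]].

Definition Qcurv n N (x : sphere n) : R :=
  if n == N.*2 then (Qcurv_poly N).[n%:R] else Qcurv_generic N x.

Definition is_composition I : bool := all (leq 1) I.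

Definition m_coef I : R :=
  - (-1) ^+ size I * (sumn I)`!%:R * (sumn I).-1`!%:R
  * \prod_(k <- I) (k`!%:R * k.-1`!%:R)^-1
  * \prod_(0 <= j < (size I).-1) (nth 0 I j + nth 0 I j.+1)%N%:R^-1.

Definition Qprimary n N (x : sphere n) : R :=
  if (N <= 1)%N then 0 else
  (-1) ^+ N * - \sum_(aJ \in [set aJ : nat * seq nat |
      [/\ (1 <= aJ.1)%N, is_composition aJ.2,
          (aJ.1 + sumn aJ.2)%N = N & aJ.1 <> N]])
    (m_coef (rcons aJ.2 aJ.1) * (-1) ^+ aJ.1
     * gjms_comp aJ.2 (@Qcurv n aJ.1) x).

Definition Lambda n N (x : sphere n) : R := Qcurv N x - Qprimary N x.

(* A formal power series is the sequence of its coefficients. *)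
Definition fps_mul (a b : nat -> R) (k : nat) : R :=
  \sum_(i < k.+1) a i * b (k - i)%N.

Definition fps_poly (p : {poly R}) (k : nat) : R := p`_k.

(* The square root with constant term 1. *)
Definition fps_sqrt (a : nat -> R) : nat -> R :=
  xget (cst 0) [set s | s 0%N = 1 /\ fps_mul s s = a].

(* [a (h (r))]; the truncation of the sum is harmless when [h] has no constant
   term, as then [h ^+ i] does not contribute to degrees below [i]. *)
Definition fps_subst (a : nat -> R) (h : {poly R}) (k : nat) : R :=
  \sum_(i < k.+1) a i * (h ^+ i)`_k.

(* [(1 - r^2 / 4)^2 g] in a [g]-orthonormal frame, ['X] standing for [r]. *)
Definition metric_r n : 'M[{poly R}]_n := ((1 - 4^-1 *: 'X^2) ^+ 2)%:M.

(* [v (r) = vol (g_r) / vol (g)], the square root of the determinant of [g_r]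
   relative to [g]. *)
Definition vol_ratio n : nat -> R := fps_sqrt (fps_poly (\det (metric_r n))).

Definition Gseries n (x : sphere n) (N : nat) : R :=
  if N == 0%N then 1 else (-1) ^+ N * Lambda N x / (N`!%:R * N.-1`!%:R).

Lemma laplacian_cst n (c : R) : laplacian (cst c : sphere n -> R) = cst 0.
Proof.
apply/funext => x; rewrite /laplacian big1 // => i _.
have -> : radial_ext (cst c : sphere n -> R) = cst c by [].
have -> : (fun y => 'D_(delta_mx 0 i) (cst c : 'rV[R]_n.+1 -> R) y) = cst 0.
  by apply/funext => y; rewrite derive_cst.
by rewrite derive_cst.
Qed.

Lemma gjms_cst n N (c : R) : @gjms n N (cst c) =
  cst (\prod_(0 <= j < N) (- (n%:R / 2 * (n%:R / 2 - 1)) + (j * j.+1)%:R) * c).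
Proof.
rewrite /gjms; elim: (index_iota 0 N) => [|j s IH].
  by rewrite !big_nil mul1r.
rewrite !big_cons /= IH; apply/funext => x.
by rewrite /yamabe laplacian_cst /= add0r -mulNr -mulrDl mulrA.
Qed.

Definition Qcurv_sphere_poly N : {poly R} :=
  2^-1 *: 'X * \prod_(1 <= j < N)
    ((2^-1 *: 'X - j%:R%:P) * (2^-1 *: 'X + j%:R%:P)).

Lemma horner_Qcurv_sphere_poly n N : (Qcurv_sphere_poly N).[n%:R] =
  n%:R / 2 * \prod_(1 <= j < N) ((n%:R / 2 - j%:R) * (n%:R / 2 + j%:R)).
Proof.
rewrite /Qcurv_sphere_poly hornerM hornerZ hornerX horner_prod.
rewrite [2^-1 * _]mulrC; congr (_ * _); apply: eq_bigr => j _.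
by rewrite hornerM !(hornerD, hornerN, hornerZ, hornerX, hornerC) [2^-1 * _]mulrC.
Qed.

Lemma Qcurv_generic_sphere n N (x : sphere n) : (0 < N)%N -> n != N.*2 ->
  Qcurv_generic N x = (Qcurv_sphere_poly N).[n%:R].
Proof.
case: N => // N _ nN; rewrite horner_Qcurv_sphere_poly.
rewrite /Qcurv_generic gjms_cst /= mulr1.
have h0 : n%:R / 2 - N.+1%:R != 0 :> R.
  rewrite subr_eq0; apply: contraNneq nN => e.
  rewrite -(eqr_nat R) -muln2 natrM -e mulfVK //.
apply: (canLR (mulfK h0)).
move: (n%:R / 2) => h {h0}.
elim: N {x nN} => [|N IH].
  by rewrite big_nat1 big_geq //; ring.
rewrite big_nat_recr //= [in RHS]big_nat_recr //= exprSr mulrACA IH; ring.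
Qed.

Lemma Qcurv_polyE N : (0 < N)%N -> Qcurv_poly N = Qcurv_sphere_poly N.
Proof.
move=> N0; rewrite /Qcurv_poly; set A := [set q | _].
have /xgetPex : exists q, A q.
  by exists (Qcurv_sphere_poly N) => m x _; exact: Qcurv_generic_sphere.
move=> /(_ 0); set q := xget 0 A => qA; apply/eqP; rewrite -subr_eq0.
set d := q - _; apply/eqP.
pose s : seq R := [seq m%:R | m <- iota N.*2.+1 (size d)].
apply: (@roots_geq_poly_eq0 _ _ s); last by rewrite size_map size_iota.
  apply/allP => _ /mapP[m + ->]; rewrite mem_iota => /andP[lm _].
  have m0 : (0 < m)%N by apply: leq_trans lm.
  have mN : m != N.*2 by rewrite gtn_eqF.
  rewrite /root /d hornerD hornerN -(qA m (pole m)) //.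
  by rewrite Qcurv_generic_sphere // subrr.
by rewrite map_inj_uniq ?iota_uniq // => i j /eqP; rewrite eqr_nat => /eqP.
Qed.

Lemma Qcurv_sphere n N (x : sphere n) : (0 < N)%N ->
  Qcurv N x = n%:R / 2 *
    \prod_(1 <= j < N) ((n%:R / 2 - j%:R) * (n%:R / 2 + j%:R)).
Proof.
move=> N0; rewrite -horner_Qcurv_sphere_poly /Qcurv.
case: eqVneq => [_|nN]; first by rewrite Qcurv_polyE.
exact: Qcurv_generic_sphere.
Qed.

Lemma fps_sqrt_unique (a s : nat -> R) :
  s 0%N = 1 -> fps_mul s s = a -> fps_sqrt a = s.
Proof.
move=> s0 sa; rewrite /fps_sqrt; set A := [set s | _].
have /xgetPex : exists s, A s by exists s.
move=> /(_ (cst 0)); set t := xget _ A => -[t0 ta]; apply/funext => k.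
elim/ltn_ind: k => -[|k] IH; first by rewrite t0.
have : fps_mul t t k.+1 = fps_mul s s k.+1 by rewrite ta sa.
rewrite /fps_mul big_ord_recl big_ord_recr.
rewrite [in RHS]big_ord_recl [in RHS]big_ord_recr /= !subn0 /bump /= !add1n.
rewrite !subnn t0 s0 !mul1r !mulr1.
have -> : \sum_(i < k) t (bump 0 i) * t (k.+1 - bump 0 i)%N =
    \sum_(i < k) s (bump 0 i) * s (k.+1 - bump 0 i)%N.
  apply: eq_bigr => i _; rewrite /bump add1n subSS !IH //.
  - by rewrite ltnS leq_subr.
  - by rewrite ltnS.
set S := \sum_(i < k) _ => e; have {}e : t k.+1 *+ 2 = s k.+1 *+ 2.
  by rewrite !mulr2n; apply: (addrI S); rewrite addrCA e addrCA.
by move/eqP: e; rewrite eqrMn2r => /eqP.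
Qed.

Lemma vol_ratioE n : vol_ratio n = fps_poly ((1 - 4^-1 *: 'X^2) ^+ n).
Proof.
apply: fps_sqrt_unique.
  rewrite /fps_poly -horner_coef0 horner_exp hornerD hornerN hornerZ hornerXn.
  by rewrite hornerC expr0n mulr0 subr0 expr1n.
apply/funext => k; rewrite /fps_mul /fps_poly -coefM /metric_r det_scalar.
by rewrite -exprD -exprM addnn mul2n.
Qed.

End Sphere.

(* Main.v *)
Require Import Defs.
From mathcomp Require Import all_boot all_order all_algebra.
From mathcomp Require Import all_classical all_reals all_analysis.
From mathcomp Require Import qpoly ring zify.
Import Order.TTheory GRing.Theory Num.Theory.
Set Implicit Arguments.
Unset Strict Implicit.
Unset Printing Implicit Defensive.
Local Open Scope ring_scope.

(** Write [h = n / 2], [(x)_m = x (x + 1) ... (x + m - 1)] and let [binom(h, k)]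
    be the generalized binomial coefficient.  Everything follows from the
    closed formula [Lambda_{2N} = N! (N - 1)! binom(h, N)] ([Lambda_sphere]).
    It says that the generating series [G (r)] is the binomial series of
    [(1 - r)^h], so that [G (r^2/4)^2 = (1 - r^2/4)^n = v (r)]: this is (ii), and
    comparing the coefficients of [r^{2N}] gives (i).  On coefficients, both are
    the Chu-Vandermonde identity [gbin_Vandermonde] for [h + h = n].

    To compute [Lambda_{2N}], note that on constant functions [P_{2k}] is the
    multiplication by [(h)_k (1 - h)_k], so that
    [(-1)^N Lambda_{2N} / (N! (N - 1)!)] is a sum over all compositions [I] of
    [N], the term [(-1)^N Q_{2N}] being that of the composition [(N)].  Up
    to the factor [N! (N - 1)!], the coefficient [m_I] is a product along [I] in
    which only the factors [1 / (I_j + I_{j+1})] couple neighbours.  Each composition thus has the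
    product weight [chain_weight], and the sum obeys a transfer recursion on
    the first part of [I]: the sum [F (k, M)] over the compositions of [M] with
    first part [k] satisfies
      [F (k, M) = - e_k * sum_l F (l, M - k) / (k + l)]  for [k < M],
    with [e_k = (h)_k (1 - h)_k / (k! (k - 1)!)].

    The generating function of the sums [sum_l F (l, m) / (z + l)], for
    varying [m], is, up to the factor [1 / (z - h)] and its constant term, the
    hypergeometric series [2F1 (-h, z - h; z + 1; t)], whose residue at
    [z = -k] is again a multiple of its value at [z = k], by the symmetry of
    hypergeometric functions with an integral lower parameter.  Degree by degree
    in [t] this is a statement about the rational function
      [(-h)_m (z - h + 1)_{m-1} / (m! (z + 1)_m)],
    whose residues at [z = -l] are the numbers [residue h l m].  Expanding it into
    partial fractions ([sum_residue_div]) shows that these residues satisfy the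
    transfer recursion ([residue_rec]), hence are the [F (l, m)]; and the
    behaviour of the function at infinity gives their sum
    [(-h)_m / m! = (-1)^m binom(h, m)] ([sum_residue]). *)

(** * Rising factorials *)

Section Rising.
Variable K : numFieldType.
Implicit Types (x y h z : K) (m k l p : nat).

Lemma fact_neq0 m : m`!%:R != 0 :> K.
Proof. by rewrite pnatr_eq0 -lt0n fact_gt0. Qed.

Definition rising x m : K := \prod_(i < m) (x + i%:R).

Lemma rising0 x : rising x 0 = 1.
Proof. exact: big_ord0. Qed.

Lemma risingSr x m : rising x m.+1 = rising x m * (x + m%:R).
Proof. exact: big_ord_recr. Qed.

Lemma risingD x m p : rising x (m + p) = rising x m * rising (x + m%:R) p.
Proof.
rewrite /rising big_split_ord; congr (_ * _); apply: eq_bigr => i _.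
by rewrite /= natrD addrA.
Qed.

Lemma risingS x m : rising x m.+1 = x * rising (x + 1) m.
Proof. by rewrite -add1n risingD risingSr rising0 mul1r addr0. Qed.

(** The factors on the left are the opposites of those of [rising x m], in
    the reverse order. *)
Lemma rising_reflect x m : rising (1 - x - m%:R) m = (-1) ^+ m * rising x m.
Proof.
elim: m x => [|m IH] x; first by rewrite !rising0 mulr1.
rewrite risingS risingSr exprS.
have -> : 1 - x - m.+1%:R + 1 = 1 - x - m%:R by ring.
by rewrite IH; ring.
Qed.

Lemma fact_rising m p : m`!%:R * rising m.+1%:R p = (m + p)`!%:R.
Proof.
elim: p => [|p IH]; first by rewrite rising0 mulr1 addn0.
by rewrite risingSr mulrA IH addnS factS natrM -natrD addSn mulrC.
Qed.

(** * Partial fractions with poles at the negative integers *)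

(** The denominators of Lagrange interpolation at consecutive integers. *)
Lemma node_prod m i : (i <= m)%N ->
  \prod_(j < m.+1 | j != i :> nat) (j%:R - i%:R) =
  (-1) ^+ i * i`!%:R * (m - i)`!%:R :> K.
Proof.
move=> le_im.
rewrite -(big_mkord (fun j => j != i) (fun j => j%:R - i%:R : K)).
rewrite (big_cat_nat (n := i)) ?leqW //= big_nat_cond.
rewrite (eq_bigl (fun j => (0 <= j < i)%N)); last first.
  by move=> j; case: ltngtP; rewrite ?andbT ?andbF.
rewrite -big_nat big_mkord [X in _ * X]big_mkcond big_ltn ?ltnS //= eqxx mul1r.
rewrite -big_mkcond /= big_nat_cond.
rewrite (eq_bigl (fun j => (i < j < m.+1)%N)); last first.
  by move=> j; case: ltngtP; rewrite ?andbT ?andbF.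
rewrite -big_nat; congr (_ * _).
  have -> : \prod_(j < i) (j%:R - i%:R) = rising (1 - 1%:R - i%:R) i.
    by apply: eq_bigr => j _; ring.
  by rewrite rising_reflect -[i in RHS]add0n -fact_rising fact0 mul1r.
have -> : (m - i)`!%:R = rising 1%:R (m - i) :> K.
  by have := fact_rising 0 (m - i); rewrite fact0 mul1r add0n.
rewrite -[i.+1]add0n big_addn subSS big_mkord; apply: eq_bigr => j _.
by rewrite addnS -natr1 natrD; ring.
Qed.

Lemma interpolation_neg_nat m (P : {poly K}) : (size P <= m.+1)%N ->
  P = \sum_(i < m.+1) ((-1) ^+ i * P.[- i.+1%:R] / (i`!%:R * (m - i)`!%:R)) *:
        \prod_(j < m.+1 | j != i) ('X + j.+1%:R%:P).
Proof.
move=> sP; pose x j : K := - j.+1%:R.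
have xI : injective x.
  by move=> j k /oppr_inj/eqP; rewrite eqr_nat eqSS => /eqP.
rewrite [LHS](lagrange_gen (ltn0Sn m) xI sP); apply: eq_bigr => i _.
rewrite lagrangeE //= mulrA -polyCM mul_polyC.
under eq_bigr do rewrite /x polyCN opprK.
congr (_ *: _); rewrite horner_prod.
under eq_bigr do rewrite hornerD hornerX hornerC.
have -> : \prod_(j < m.+1 | j != i) (x i + j.+1%:R) =
    \prod_(j < m.+1 | j != i :> nat) (j%:R - i%:R).
  by apply: eq_big => // j _; rewrite /x; ring.
rewrite node_prod; last by rewrite -ltnS.
by rewrite !invfM invr_sign; ring.
Qed.

(** Lagrange interpolation at [-1, ..., -(m + 1)], divided by the polynomial
    [(z + 1) ... (z + m + 1)] that vanishes at the nodes. *)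
Lemma partial_fractions m (P : {poly K}) z : (size P <= m.+1)%N ->
  (forall i, z + i.+1%:R != 0) ->
  \sum_(i < m.+1) ((-1) ^+ i * P.[- i.+1%:R] / (i`!%:R * (m - i)`!%:R))
    / (z + i.+1%:R) = P.[z] / rising (z + 1) m.+1.
Proof.
move=> sP z0; rewrite [in RHS](interpolation_neg_nat sP) horner_sum mulr_suml.
apply: eq_bigr => i _; rewrite hornerZ -[RHS]mulrA; congr (_ * _).
have -> : rising (z + 1) m.+1 = \prod_(j < m.+1) (z + j.+1%:R).
  by apply: eq_bigr => j _; rewrite -natr1; ring.
rewrite horner_prod [in X in _ / X](bigD1 i) //= invfM mulrCA.
under eq_bigr do rewrite hornerD hornerX hornerC.
by rewrite divff ?mulr1 //; apply/prodf_neq0 => j _; exact: z0.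
Qed.

(** Compare the leading coefficients in the interpolation formula: each of its
    basis polynomials is monic of degree [m].  In analytic terms, this is the
    residue at infinity of the expansion [partial_fractions]. *)
Lemma sum_residues m (P : {poly K}) : (size P <= m.+1)%N ->
  \sum_(i < m.+1) (-1) ^+ i * P.[- i.+1%:R] / (i`!%:R * (m - i)`!%:R) = P`_m.
Proof.
move=> sP; rewrite [in RHS](interpolation_neg_nat sP) coef_sum.
apply: eq_bigr => i _; rewrite coefZ.
under eq_bigr do rewrite -[_%:P]opprK -polyCN.
set Q := \prod_(j < _ | _) _.
have sQ : size Q = m.+1.
  rewrite /Q -big_filter size_prod_XsubC -sum1_size big_filter sum1_card.
  by rewrite cardC1 card_ord.
have -> : Q`_m = lead_coef Q by rewrite lead_coefE sQ.
by rewrite (monicP (monic_prod_XsubC _ _ _)) mulr1.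
Qed.

(** * The transfer recursion *)

(** The residue at [z = - l] of
    [rising (- h) m * rising (z - h + 1) m.-1 / (m! * rising (z + 1) m)]; see
    [sum_residue_div].  It turns out to be the total weight of the compositions
    of [m] with first part [l]. *)
Definition residue h l m : K :=
  (-1) ^+ l.-1 * rising (- h) m * rising (1 - l%:R - h) m.-1
  / (m`!%:R * (l.-1`!%:R * (m - l)`!%:R)).

(** The roots are written as [- (x + i)] to fit the lemmas on products of
    factors ['X - c%:P]. *)
Definition rising_poly x m : {poly K} := \prod_(i < m) ('X - (- (x + i%:R))%:P).

Lemma horner_rising_poly x m z : (rising_poly x m).[z] = rising (z + x) m.
Proof.
rewrite horner_prod; apply: eq_bigr => i _.
by rewrite hornerXsubC; ring.
Qed.

Lemma size_rising_poly x m : size (rising_poly x m) = m.+1.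
Proof. by rewrite size_prod_XsubC -sum1_size sum1_card card_ord. Qed.

Lemma sum_residue h m : (0 < m)%N ->
  \sum_(1 <= l < m.+1) residue h l m = rising (- h) m / m`!%:R.
Proof.
case: m => // m _; rewrite big_add1 big_mkord /=.
have sP : (size (rising_poly (1 - h) m) <= m.+1)%N by rewrite size_rising_poly.
transitivity (rising (- h) m.+1 / m.+1`!%:R * (rising_poly (1 - h) m)`_m).
  rewrite -(sum_residues sP) mulr_sumr; apply: eq_bigr => i _.
  rewrite horner_rising_poly /residue /= subSS.
  have -> : - i.+1%:R + (1 - h) = 1 - i.+1%:R - h by ring.
  by rewrite invfM; ring.
have := lead_coefE (rising_poly (1 - h) m); rewrite size_rising_poly /= => <-.
by rewrite (monicP (monic_prod_XsubC _ _ _)) mulr1.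
Qed.

Lemma sum_residue_div h m k : (0 < m)%N ->
  \sum_(1 <= l < m.+1) residue h l m / (k + l)%:R =
  rising (- h) m * rising (k.+1%:R - h) m.-1 / (m`!%:R * rising k.+1%:R m).
Proof.
case: m => // m _; rewrite big_add1 big_mkord /=.
have sP : (size (rising_poly (1 - h) m) <= m.+1)%N by rewrite size_rising_poly.
have k0 i : k%:R + i.+1%:R != 0 :> K by rewrite -natrD addnS pnatr_eq0.
transitivity (rising (- h) m.+1 / m.+1`!%:R *
    ((rising_poly (1 - h) m).[k%:R] / rising (k%:R + 1) m.+1)).
  rewrite -(partial_fractions sP k0) mulr_sumr; apply: eq_bigr => i _.
  rewrite horner_rising_poly /residue /= subSS.
  have -> : - i.+1%:R + (1 - h) = 1 - i.+1%:R - h by ring.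
  by rewrite natrD [in LHS]invfM; ring.
rewrite horner_rising_poly natr1 invfM.
have -> : k%:R + (1 - h) = k.+1%:R - h by rewrite -natr1; ring.
by ring.
Qed.

(** The contribution of [P_{2k}] to a composition: its eigenvalue on constants,
    normalized by the factorials of [m_I]. *)
Definition edge_weight h k : K :=
  rising h k * rising (1 - h) k / (k`!%:R * k.-1`!%:R).

(** The contribution [(-1)^a Q_{2a} / (a! (a - 1)!)] of the last part; see
    [signed_Qcurv]. *)
Definition end_weight h a : K :=
  rising (- h) a * rising (1 + h) a.-1 / (a`!%:R * a.-1`!%:R).

Lemma residue_diag h m : (0 < m)%N -> residue h m m = end_weight h m.
Proof.
case: m => // m _; rewrite /residue /end_weight /= subnn fact0 mulr1.
have -> : 1 - m.+1%:R - h = 1 - (1 + h) - m%:R by rewrite -natr1; ring.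
rewrite rising_reflect.
have := sqrr_sign K m; rewrite expr2; move: ((-1) ^+ m) => s ss.
congr (_ / _); rewrite -[RHS]mul1r -ss; ring.
Qed.

(** The residue at [- k] of the function of index [k + m] is, up to the factor
    [- edge_weight h k], the value at [k] of the function of index [m], which
    [sum_residue_div] expands.  Every
    factor is expressed by [rising h k], [rising (1 - h) k],
    [rising (1 - h) m.-1] and [rising (k + 1 - h) m.-1]. *)
Lemma residue_rec h k m : (0 < k)%N -> (0 < m)%N ->
  residue h k (k + m) = - edge_weight h k *
    \sum_(1 <= l < m.+1) residue h l m / (k + l)%:R.
Proof.
move=> k_gt0 m_gt0; rewrite sum_residue_div // /residue /edge_weight.
rewrite addKn -fact_rising.
have -> : rising (- h) (k + m) =
    - h * rising (1 - h) k * rising (k.+1%:R - h) m.-1.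
  rewrite -(prednK m_gt0) addnS risingS risingD mulrA /=.
  by congr (_ * rising _ _ * rising _ _); rewrite -?natr1; ring.
have -> : rising (- h) m = - h * rising (1 - h) m.-1.
  by rewrite -[in LHS](prednK m_gt0) risingS addrC.
have -> : rising (1 - k%:R - h) (k + m).-1 =
    (-1) ^+ k * rising h k * rising (1 - h) m.-1.
  rewrite -[in LHS](prednK m_gt0) addnS risingD -rising_reflect.
  by congr (rising _ _ * rising _ _); ring.
have <- : - (-1) ^+ k = (-1) ^+ k.-1 :> K.
  by rewrite -[in LHS](prednK k_gt0) exprS mulN1r opprK.
have := sqrr_sign K k; rewrite expr2; move: ((-1) ^+ k) => s ss.
rewrite !invfM -[RHS]mul1r -ss; ring.
Qed.

End Rising.

(** * Compositions with a distinguished last part *)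

(** The compositions [(J, a)] of [M], stored as [(a, J)] and enumerated by the
    first part.  The head of the list is the composition with one part, which
    the primary part excludes.  Any [fuel >= M - 1] suffices, as each part is
    at least [1]. *)
Fixpoint pointed_comps (fuel M : nat) : seq (nat * seq nat) :=
  (M, [::]) ::
  if fuel is fuel'.+1 then
    [seq (aJ.1, k :: aJ.2) | k <- iota 1 M.-1, aJ <- pointed_comps fuel' (M - k)%N]
  else [::].

Lemma pointed_compsS fuel M : pointed_comps fuel.+1 M = (M, [::]) ::
  [seq (aJ.1, k :: aJ.2) | k <- iota 1 M.-1, aJ <- pointed_comps fuel (M - k)%N].
Proof. by []. Qed.

Lemma pointed_compsP fuel M (aJ : nat * seq nat) : (0 < M <= fuel.+1)%N ->
  reflect [/\ (0 < aJ.1)%N, is_composition aJ.2 & (aJ.1 + sumn aJ.2)%N = M]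
    (aJ \in pointed_comps fuel M).
Proof.
case: aJ => a J.
elim: J fuel M => [|k J IH] fuel M /andP[M0 MF].
  apply: (iffP idP) => [|[/= _ _]]; last first.
    by rewrite addn0 => ->; case: fuel {MF} => [|fuel]; rewrite inE eqxx.
  case: fuel {MF} => [|fuel]; rewrite inE.
    by case/orP=> // /eqP[->]; rewrite /= addn0.
  case/orP=> [/eqP[->]|/allpairsPdep[k [y [_ _ //]]]].
  by rewrite /= addn0.
case: fuel MF => [|fuel] MF.
  apply: (iffP idP) => [|[/= a0 /andP[k0 _]]]; first by rewrite inE xpair_eqE andbF.
  by rewrite /= => e; lia.
rewrite inE xpair_eqE andbF /=; apply: (iffP allpairsPdep).
  move=> [k' [[a' J'] [kM aJM /= [ea ek eJ]]]].
  move: aJM kM; rewrite -ea -ek -eJ mem_iota => aJM kM.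
  move/IH: aJM => [] /=; first by lia.
  by move=> a0 cJ e; split=> //; [rewrite /= cJ andbT|]; lia.
move=> /= [a0 /andP[k0 cJ] e]; exists k, (a, J); split=> //.
  by rewrite mem_iota; lia.
have kM : (0 < M - k <= fuel.+1)%N by lia.
by apply/(IH _ _ kM); split=> //=; lia.
Qed.

Lemma pointed_comps_uniq fuel M : uniq (pointed_comps fuel M).
Proof.
elim: fuel M => [|fuel IH] M //=.
apply/andP; split; first by apply/allpairsPdep => -[k [y [_ _ //]]].
apply: allpairs_uniq_dep; [exact: iota_uniq | by move=> k _; exact: IH |].
by move=> [k [a J]] [l [b L]] _ _ /= [-> -> ->].
Qed.

Section Compositions.
Variables (K : numFieldType) (h : K).
Implicit Types (aJ : nat * seq nat).

Definition first_part aJ : nat := head aJ.1 aJ.2.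

(** The weight of the composition [(J, a)], which is
    [m_(J,a) (-1)^a P_{2J} (Q_{2a}) / (N! (N - 1)!)] with [N] the sum of the
    parts; see [primary_summandE]. *)
Fixpoint chain_weight a J : K :=
  if J is k :: J' then
    - edge_weight h k / (k + first_part (a, J'))%:R * chain_weight a J'
  else end_weight h a.

(** Testing against a function [phi] of the first part makes the induction
    work: after removal of the first part [k], the remaining sum is the one for
    [M - k] with [phi l = 1 / (k + l)], so that [residue_rec] applies. *)
Lemma sum_chain_weight (phi : nat -> K) fuel M : (0 < M <= fuel.+1)%N ->
  \sum_(aJ <- pointed_comps fuel M) phi (first_part aJ) * chain_weight aJ.1 aJ.2
  = \sum_(1 <= l < M.+1) phi l * residue h l M.
Proof.
elim: fuel M phi => [|fuel IH] M phi /andP[M0 MF].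
  have -> : M = 1%N by lia.
  by rewrite big_seq1 big_nat1 residue_diag.
rewrite pointed_compsS big_cons big_nat_recr //= residue_diag // addrC.
congr (_ + _); rewrite big_allpairs_dep.
have -> : index_iota 1 M = iota 1 M.-1 by rewrite /index_iota subn1.
rewrite !big_seq; apply: eq_bigr => k; rewrite mem_iota => kM.
have -> : residue h k M = - edge_weight h k *
    \sum_(1 <= l < (M - k).+1) residue h l (M - k) / (k + l)%:R.
  by rewrite -residue_rec ?subnKC //; lia.
transitivity (phi k * - edge_weight h k *
  \sum_(aJ <- pointed_comps fuel (M - k)%N)
     (k + first_part aJ)%:R^-1 * chain_weight aJ.1 aJ.2).
  rewrite mulr_sumr; apply: eq_bigr => -[a J] _ /=.
  by rewrite !mulrA.
rewrite -mulrA; congr (_ * (_ * _)).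
rewrite (IH _ (fun l => (k + l)%:R^-1)); last by lia.
by apply: eq_bigr => l _; rewrite mulrC.
Qed.

End Compositions.

(** * Generalized binomial coefficients *)

Section Binomial.
Variable K : numFieldType.
Implicit Types (x y : K).

Definition gbin x k : K := \prod_(i < k) (x - i%:R) / k`!%:R.

Lemma gbin0 x : gbin x 0 = 1.
Proof. by rewrite /gbin big_ord0 fact0 divr1. Qed.

Lemma gbinS x k : k.+1%:R * gbin x k.+1 = (x - k%:R) * gbin x k.
Proof.
rewrite /gbin big_ord_recr factS natrM /=.
by field; rewrite fact_neq0 nat1r pnatr_eq0.
Qed.

Lemma rising_oppE x k : rising (- x) k / k`!%:R = (-1) ^+ k * gbin x k.
Proof.
rewrite /gbin mulrA; congr (_ / _).
elim: k => [|k IH]; first by rewrite rising0 big_ord0 mulr1.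
by rewrite risingSr big_ord_recr IH exprS /=; ring.
Qed.

Lemma gbin_nat n k : gbin n%:R k = 'C(n, k)%:R.
Proof.
apply: (canLR (mulfK (fact_neq0 _ _))); rewrite -natrM bin_ffact.
elim: k => [|k IH]; first by rewrite big_ord0 ffactn0.
rewrite big_ord_recr /= IH ffactnSr natrM.
case: (leqP k n) => [kn|nk]; first by rewrite natrB.
by rewrite ffact_small // !mul0r.
Qed.

(** Both sides satisfy [(k + 1) d_{k+1} = (x + y - k) d_k]; for the convolution
    on the left, split [k + 1 = i + (k + 1 - i)] in each term and shift the
    index in the first half. *)
Lemma gbin_Vandermonde x y k :
  \sum_(i < k.+1) gbin x i * gbin y (k - i)%N = gbin (x + y) k.
Proof.
elim: k => [|k IH]; first by rewrite big_ord1 !gbin0 mul1r.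
apply: (@mulfI _ k.+1%:R); first by rewrite pnatr_eq0.
rewrite gbinS -IH !mulr_sumr.
transitivity (\sum_(i < k.+2) i%:R * gbin x i * gbin y (k.+1 - i)%N
   + \sum_(i < k.+2) gbin x i * ((k.+1 - i)%:R * gbin y (k.+1 - i)%N)).
  rewrite -big_split; apply: eq_bigr => i _ /=.
  have ik : (i <= k.+1)%N by rewrite -ltnS.
  by rewrite natrB //; ring.
rewrite big_ord_recl /= !mul0r add0r [X in _ + X]big_ord_recr /= subnn.
rewrite mul0r mulr0 addr0 -big_split; apply: eq_bigr => i _ /=.
have ik : (i <= k)%N by rewrite -ltnS.
rewrite /bump add1n subSS gbinS subSn // gbinS natrB //; ring.
Qed.

End Binomial.

(** * The primary part on the sphere *)

Section Sphere.
Variables (R : realType) (n : nat).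
Let h : R := n%:R / 2.
Implicit Types (x : sphere R n) (a k N : nat) (J : seq nat).

Lemma gjms_eigenvalue N :
  \prod_(0 <= j < N) (- (h * (h - 1)) + (j * j.+1)%:R)
  = rising h N * rising (1 - h) N.
Proof.
rewrite big_mkord -big_split; apply: eq_bigr => j _ /=.
by rewrite natrM -natr1; ring.
Qed.

Lemma gjms_comp_cst J (c : R) : @gjms_comp R n J (cst c) =
  cst (\prod_(k <- J) (rising h k * rising (1 - h) k) * c).
Proof.
rewrite /gjms_comp; elim: J => [|k J IH]; first by rewrite !big_nil mul1r.
by rewrite !big_cons /= IH gjms_cst gjms_eigenvalue mulrA.
Qed.

Lemma signed_Qcurv a x : (0 < a)%N ->
  (-1) ^+ a * Qcurv a x = rising (- h) a * rising (1 + h) a.-1.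
Proof.
case: a => // a _; rewrite Qcurv_sphere // -/h.
rewrite big_add1 big_mkord big_split /= risingS exprS.
have -> : \prod_(i < a) (h + i.+1%:R) = rising (1 + h) a.
  by apply: eq_bigr => i _; rewrite -natr1; ring.
suff -> : rising (- h + 1) a = (-1) ^+ a * \prod_(i < a) (h - i.+1%:R) by ring.
elim: a => [|a IH]; first by rewrite rising0 big_ord0 mulr1.
by rewrite risingSr big_ord_recr IH exprS /= -natr1; ring.
Qed.

(** The recursive weight, written out in the shape of [m_I]. *)
Lemma chain_weightE a J : chain_weight h a J =
  - (-1) ^+ (size J).+1
  * \prod_(k <- rcons J a) (k`!%:R * k.-1`!%:R)^-1
  * \prod_(0 <= j < size J) (nth 0 (rcons J a) j + nth 0 (rcons J a) j.+1)%N%:R^-1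
  * (\prod_(k <- J) (rising h k * rising (1 - h) k)
     * (rising (- h) a * rising (1 + h) a.-1)).
Proof.
elim: J => [|k J IH].
  by rewrite /= big_seq1 big_geq // big_nil /end_weight expr1; ring.
rewrite rcons_cons [size (k :: J)]/= big_nat_recl // !big_cons /= IH /edge_weight.
have -> : nth 0 (rcons J a) 0 = first_part (a, J) by case: J {IH}.
by rewrite [(-1) ^+ (size J).+2]exprS !invfM; ring.
Qed.

Lemma primary_summandE a J x : (0 < a)%N ->
  m_coef R (rcons J a) * (-1) ^+ a * gjms_comp J (@Qcurv R n a) x =
  (a + sumn J)`!%:R * (a + sumn J).-1`!%:R * chain_weight h a J.
Proof.
move=> a0; have -> : @Qcurv R n a = cst (Qcurv a x).
  by apply/funext => y; rewrite !Qcurv_sphere.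
rewrite gjms_comp_cst chain_weightE -(signed_Qcurv x) //.
by rewrite /m_coef size_rcons sumn_rcons [(sumn J + a)%N]addnC succnK /cst; ring.
Qed.

(** [Lambda] is, up to sign and factorials, the sum of [chain_weight] over all
    compositions of [N]: [Q_{2N}] supplies the composition [(N)] and the primary
    part all the others. *)
Lemma Lambda_sphere N x : (0 < N)%N ->
  Lambda N x = N`!%:R * N.-1`!%:R * gbin h N.
Proof.
move=> N0.
have signK (u v : R) : (-1) ^+ N * u = (-1) ^+ N * v -> u = v.
  by apply: mulfI; rewrite signr_eq0.
apply: signK; rewrite [RHS]mulrCA -rising_oppE -sum_residue //.
have NN : (0 < N <= N.-1.+1)%N by rewrite prednK // N0 /=.
have := sum_chain_weight h (fun=> 1) NN.
under eq_bigr do rewrite mul1r; under [in RHS]eq_bigr do rewrite mul1r.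
move=> <-; rewrite mulr_sumr /Lambda mulrBr signed_Qcurv //.
rewrite /Qprimary; case: ifP => N1.
  (* The list reduces to the composition [(1)], and [Q_2] is not corrected. *)
  have -> : N = 1%N by lia.
  rewrite big_seq1 /= /end_weight mulr0 subr0; field; exact: fact_neq0.
rewrite [X in _ - X]mulrA -expr2 sqrr_sign mul1r opprK.
case eN: N.-1 => [|f]; first by lia.
rewrite pointed_compsS big_cons /= -eN; congr (_ + _).
  rewrite /end_weight; field; by rewrite !fact_neq0.
set s := flatten _.
have us : uniq s by have := pointed_comps_uniq f.+1 N => /= /andP[].
(* As all parts are positive, [a <> N] means that [J] is not empty. *)
have sE aJ : aJ \in s <-> [/\ (1 <= aJ.1)%N, is_composition aJ.2,
          (aJ.1 + sumn aJ.2)%N = N & aJ.1 <> N].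
  have Nf : (0 < N <= f.+2)%N by lia.
  have NP := @pointed_compsP f.+1 N aJ Nf.
  split=> [sx|[a0 cJ e neN]].
    have /NP[a0 cJ e] : aJ \in pointed_comps f.+1 N.
      by rewrite pointed_compsS inE sx orbT.
    split=> //; case/allpairsPdep: sx => k [y [+ _ eaJ]].
    by rewrite mem_iota; move: e; rewrite eaJ /=; lia.
  have : aJ \in pointed_comps f.+1 N by apply/NP.
  by rewrite pointed_compsS inE => /orP[/eqP eaJ|//]; case: neN; rewrite eaJ.
have -> : [set aJ : nat * seq nat | [/\ (1 <= aJ.1)%N, is_composition aJ.2,
    (aJ.1 + sumn aJ.2)%N = N & aJ.1 <> N]]%classic = [set` s]%classic.
  by apply/seteqP; split=> aJ /= /sE.
rewrite -fsbig_seq // !big_seq; apply: eq_bigr => aJ /sE[a0 _ e _].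
by rewrite primary_summandE // e.
Qed.

Lemma GseriesE N x : Gseries x N = (-1) ^+ N * gbin h N.
Proof.
rewrite /Gseries; case: N => [|N] /=; first by rewrite gbin0 mulr1.
rewrite Lambda_sphere //= mulrCA; field.
by rewrite !fact_neq0.
Qed.

End Sphere.

(** * Power series in the square of the variable *)

Section EvenSeries.
Variable K : realType.
Implicit Types (c d : nat -> K).

Definition even_series c (k : nat) : K := if odd k then 0 else c k./2.

Lemma sum_even (f : nat -> K) N : (forall i, odd i -> f i = 0) ->
  \sum_(i < N.*2.+1) f i = \sum_(j < N.+1) f j.*2.
Proof.
move=> f0; elim: N => [|N IH]; first by rewrite !big_ord1.
by rewrite doubleS 2!big_ord_recr /= IH f0 ?addr0 /= ?odd_double // [RHS]big_ord_recr.
Qed.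

Lemma fps_mul_even c d :
  fps_mul (even_series c) (even_series d) = even_series (fps_mul c d).
Proof.
apply/funext => k; rewrite /fps_mul {3}/even_series.
case: ifPn => ok.
  apply: big1 => i _; rewrite /even_series oddB -1?ltnS // ok.
  by case: (odd i); rewrite ?mul0r ?mulr0.
have [N {ok}->] : exists N, k = N.*2 by exists k./2; rewrite even_halfK.
rewrite (@sum_even (fun i => even_series c i * even_series d (N.*2 - i)%N)).
  rewrite doubleK; apply: eq_bigr => j _.
  by rewrite /even_series -doubleB !odd_double !doubleK.
by move=> i oi; rewrite /even_series oi mul0r.
Qed.

Lemma fps_subst_quadratic c (t : K) :
  fps_subst c (t *: 'X^2) = even_series (fun j => t ^+ j * c j).
Proof.
apply/funext => k; rewrite /fps_subst /even_series.
under eq_bigr do rewrite exprZn -exprM coefZ coefXn.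
case: ifPn => ok.
  apply: big1 => i _; case: eqP => [ki|_]; last by rewrite !mulr0.
  by have := congr1 odd ki; rewrite ok mul2n odd_double.
have kk : (k./2 < k.+1)%N by lia.
rewrite (bigD1 (Ordinal kk)) //= mul2n even_halfK // eqxx mulr1 mulrC.
rewrite big1 ?addr0 // => i ik; case: eqP => [e|_]; last by rewrite !mulr0.
by case/eqP: ik; apply: val_inj => /=; lia.
Qed.

Lemma coef_quadratic_expn n (t : K) k :
  ((1 + t *: 'X^2) ^+ n)`_k = even_series (fun j => t ^+ j * 'C(n, j)%:R) k.
Proof.
rewrite exprDn coef_sum /even_series.
under eq_bigr do
  rewrite expr1n mul1r coefMn -mulr_natr exprZn -exprM coefZ coefXn.
case: ifPn => ok.
  apply: big1 => i _; case: eqP => [ki|_]; last by rewrite mulr0 mul0r.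
  by have := congr1 odd ki; rewrite ok mul2n odd_double.
have [N {ok}->] : exists N, k = N.*2 by exists k./2; rewrite even_halfK.
rewrite doubleK; case: (ltnP N n.+1) => [Nn|nN]; last first.
  rewrite bin_small // mulr0 big1 // => i _; case: eqP => [e|_].
    by have := ltn_ord i; lia.
  by rewrite mulr0 mul0r.
rewrite (bigD1 (Ordinal Nn)) //= mul2n eqxx mulr1 big1 ?addr0 // => i iN.
case: eqP => [e|_]; last by rewrite mulr0 mul0r.
by case/eqP: iN; apply: val_inj => /=; lia.
Qed.

End EvenSeries.

(** * Holographic formulas *)

(** With [u_j] the coefficients of [G], the summand of index [j] in (i) is
    [N! (N - 1)! (-1)^N u_j u_{N-j}], and the term [2 Lambda_{2N}] accounts for
    the indices [0] and [N] of the Cauchy square of [G]. *)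
Theorem theorem9p1 (R : realType) (n : nat) (hn : (3 <= n)%N) :
  (forall N : nat, (1 <= N)%N -> (~~ odd n -> (2 * N <= n)%N) ->
   forall x : sphere R n,
     2 * Lambda N x
     + \sum_(1 <= j < N) (j * (N - j))%:R / N%:R * 'C(N, j)%:R ^+ 2
         * Lambda (N - j) x * Lambda j x
     = (-1) ^+ N * N`!%:R * N.-1`!%:R * 2 ^+ (2 * N) * vol_ratio R n (2 * N))
  /\
  (forall x : sphere R n,
     fps_subst (Gseries x) (4^-1 *: 'X^2) = fps_sqrt (vol_ratio R n)).
Proof.
pose h : R := n%:R / 2.
have hh : h + h = n%:R by rewrite /h; field.
have volE : vol_ratio R n = even_series (fun j => (- 4^-1) ^+ j * 'C(n, j)%:R).
  rewrite vol_ratioE; apply/funext => k.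
  by rewrite /fps_poly -scaleNr coef_quadratic_expn.
split=> [N N1 _ x|x]; last first.
  apply/esym/fps_sqrt_unique; rewrite fps_subst_quadratic.
    by rewrite /even_series /= mul1r.
  rewrite fps_mul_even volE; congr even_series; apply/funext => k.
  rewrite -gbin_nat -hh -gbin_Vandermonde mulr_sumr.
  apply: eq_bigr => i _; rewrite !GseriesE -/h.
  have ik : (i <= k)%N by rewrite -ltnS.
  have -> : (- 4^-1 : R) ^+ k = (- 4^-1) ^+ i * (- 4^-1) ^+ (k - i).
    by rewrite -exprD subnKC.
  by rewrite ![(- 4^-1) ^+ _]exprNn; ring.
rewrite volE /even_series mul2n odd_double doubleK -gbin_nat -hh.
have signE : (-1) ^+ N * 2 ^+ N.*2 * (- 4^-1) ^+ N = 1 :> R.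
  by rewrite -mul2n exprM -!exprMn -[RHS](expr1n _ N); congr (_ ^+ N); field.
transitivity (N`!%:R * N.-1`!%:R * gbin (h + h) N); last first.
  rewrite -[LHS]mul1r -[X in X * _ = _]signE; ring.
rewrite -gbin_Vandermonde mulr_sumr.
rewrite -(big_mkord xpredT
  (fun i => N`!%:R * N.-1`!%:R * (gbin h i * gbin h (N - i)%N))).
rewrite big_ltn // big_nat_recr //= subn0 subnn gbin0 Lambda_sphere // -/h.
suff -> : \sum_(1 <= j < N) (j * (N - j))%:R / N%:R * 'C(N, j)%:R ^+ 2
      * Lambda (N - j) x * Lambda j x
    = \sum_(1 <= j < N) N`!%:R * N.-1`!%:R * (gbin h j * gbin h (N - j)%N) by ring.
apply: eq_big_nat => j /andP[j0 jN].
rewrite !Lambda_sphere ?subn_gt0 // -/h.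
have factE m : (0 < m)%N -> m`!%:R = m%:R * m.-1`!%:R :> R.
  by case: m => // m _; rewrite factS natrM.
have N0 : N%:R != 0 :> R by rewrite pnatr_eq0 -lt0n.
have binE : 'C(N, j)%:R * (j%:R * j.-1`!%:R * ((N - j)%:R * (N - j).-1`!%:R))
    = N%:R * N.-1`!%:R :> R.
  rewrite -(factE j) -?(factE (N - j)%N) -?(factE N) ?subn_gt0 // -!natrM.
  by rewrite bin_fact // ltnW.
rewrite (factE N) ?(factE (N - j)%N) ?(factE j) ?subn_gt0 // natrM.
transitivity (('C(N, j)%:R * (j%:R * j.-1`!%:R * ((N - j)%:R * (N - j).-1`!%:R)))
  ^+ 2 / N%:R * (gbin h j * gbin h (N - j)%N)); first by ring.
by rewrite binE; field.
Qed.
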